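(* Up to isomorphism, the class of $AI_4$-free matroids is the union of the two classes $$\mathcal M_0=\{\gamma_k\cdots\gamma_1(N_0)\mid k\ge 0,\ \gamma_i\in\{\alpha_0,\alpha_1,\beta_1\},\ N_0\in\mathcal N_0\}$$ and $$\mathcal M_1=\{\gamma_k\cdots\gamma_1\,\beta_0(M)\mid k\ge 0,\ \gamma_i\in\{\alpha_0,\alpha_1\},\ M\in\mathcal M_0\},$$ where $\mathcal N_0$ is the set of $1$-dimensional matroids, and for $k=0$ the sequence of operations $\gamma_k\cdots\gamma_1$ is empty.
   Context: A matroid here means a pair $M=(E,G)$, where $G=\mathrm{PG}(n-1,2)$ is identified with $\mathbb F_2^n\setminus\{0\}$, $n\ge 1$, and $E\subseteq G$ is arbitrary; $n$ is the dimension of $M$. $(E_1,G_1)$ and $(E_2,G_2)$ are isomorphic if some linear isomorphism maps $G_1$ to $G_2$ and $E_1$ to $E_2$. A flat of $G$ is a set $F\subseteq G$ with $F\cup\{0\}$ a linear subspace; a hyperplane is a maximal proper flat. $M=(E,G)$ is $AI_4$-free if for every linearly independent set $\{x_1,x_2,x_3,x_4\}\subseteq E$ of four elements there is some $i\in\{1,2,3,4\}$ with $\sum_{j\ne i}x_j\in E$. For an $n$-dimensional matroid $M=(E,G)$, define four $(n+1)$-dimensional matroids $(E',G')$ (each well defined up to isomorphism), where $G$ is embedded as a hyperplane of the $(n+1)$-dimensional geometry $G'$ and $w$ is an element of $G'\setminus G$: - $\alpha_0(M)$: $E'=E$; - $\alpha_1(M)$: $E'=E\cup(G'\setminus G)$;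 - $\beta_0(M)$: $E'=(w+E)\cup\{w\}$; - $\beta_1(M)$: $E'=G\cup(w+E)\cup\{w\}$. *)

(* Defs.v *)
From HB Require Import structures.
From mathcomp Require Import all_boot all_order all_algebra.
From Stdlib Require List.

Set Implicit Arguments.
Unset Strict Implicit.
Unset Printing Implicit Defensive.

Import GRing.Theory.
Local Open Scope ring_scope.

(* The projective geometry PG(n-1, 2), as the nonzero vectors of F_2^n. *)
Definition PG (n : nat) : {set 'rV['F_2]_n} := [set x | x != 0].

Record matroid := Matroid {
  mdim : nat;
  elts : {set 'rV['F_2]_mdim};
  mdim_gt0 : (0 < mdim)%N;
  elts_sub : elts \subset PG mdim
}.

Definition isomorphic (M N : matroid) : Prop :=
  exists f : {linear 'rV['F_2]_(mdim M) -> 'rV['F_2]_(mdim N)},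
    [/\ bijective f, f @: PG (mdim M) = PG (mdim N) & f @: elts M = elts N].

Definition AI4_free (M : matroid) : Prop :=
  forall x : 4.-tuple 'rV['F_2]_(mdim M),
    free x -> {subset x <= elts M} ->
    exists i : 'I_4, \sum_(j < 4 | j != i) tnth x j \in elts M.

(* The operations alpha_0, alpha_1, beta_0, beta_1 are only defined up to
   isomorphism; we fix the representative in which F_2^n is the hyperplane of
   F_2^(n+1) where the last coordinate vanishes, and w is the last unit
   vector. *)
Section Extensions.
Variable n : nat.
Implicit Type E : {set 'rV['F_2]_n}.

Definition emb (x : 'rV['F_2]_n) : 'rV['F_2]_(n + 1) := row_mx x 0.
Definition apex : 'rV['F_2]_(n + 1) := row_mx 0 1%:M.

Definition alpha0_set E := emb @: E.
Definition alpha1_set E := emb @: E :|: (PG (n + 1) :\: emb @: PG n).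
Definition beta0_set E := [set apex + emb x | x in E] :|: [set apex].
Definition beta1_set E :=
  emb @: PG n :|: [set apex + emb x | x in E] :|: [set apex].

Lemma emb_neq0 x : x != 0 -> emb x != 0.
Proof.
by apply: contra_neq; rewrite /emb -(@row_mx0 _ 1 n 1) => /eq_row_mx[].
Qed.

Lemma apex_emb_neq0 x : apex + emb x != 0.
Proof.
apply/eqP; rewrite /apex /emb add_row_mx -(@row_mx0 _ 1 n 1) addr0.
by case/eq_row_mx => _ /matrixP/(_ 0 0); rewrite !mxE.
Qed.

Lemma apex_neq0 : apex != 0.
Proof. by have := apex_emb_neq0 0; rewrite /emb row_mx0 addr0. Qed.

Lemma emb_sub E : E \subset PG n -> emb @: E \subset PG (n + 1).
Proof.
move=> /subsetP sE; apply/subsetP => _ /imsetP[x /sE xP ->].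
by rewrite inE in xP; rewrite inE emb_neq0.
Qed.

Lemma apex_emb_sub E : [set apex + emb x | x in E] \subset PG (n + 1).
Proof.
by apply/subsetP => _ /imsetP[x _ ->]; rewrite inE apex_emb_neq0.
Qed.

Lemma apex_sub : [set apex] \subset PG (n + 1).
Proof. by rewrite sub1set inE apex_neq0. Qed.

Lemma alpha1_sub E : E \subset PG n -> alpha1_set E \subset PG (n + 1).
Proof. by move=> sE; rewrite subUset emb_sub ?subsetDl. Qed.

Lemma beta0_sub E : beta0_set E \subset PG (n + 1).
Proof. by rewrite subUset apex_emb_sub apex_sub. Qed.

Lemma beta1_sub E : beta1_set E \subset PG (n + 1).
Proof. by rewrite !subUset emb_sub // apex_emb_sub apex_sub. Qed.

Lemma ext_gt0 : (0 < n + 1)%N.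
Proof. by rewrite addn1. Qed.

End Extensions.

Definition alpha0 (M : matroid) : matroid :=
  @Matroid (mdim M + 1) (alpha0_set (elts M)) (ext_gt0 _)
    (emb_sub (elts_sub M)).
Definition alpha1 (M : matroid) : matroid :=
  @Matroid (mdim M + 1) (alpha1_set (elts M)) (ext_gt0 _)
    (alpha1_sub (elts_sub M)).
Definition beta0 (M : matroid) : matroid :=
  @Matroid (mdim M + 1) (beta0_set (elts M)) (ext_gt0 _) (beta0_sub _).
Definition beta1 (M : matroid) : matroid :=
  @Matroid (mdim M + 1) (beta1_set (elts M)) (ext_gt0 _) (beta1_sub _).

(* For gs = [:: g_1; ...; g_k], this is g_k (... (g_1 M)). *)
Definition apply_ops (gs : seq (matroid -> matroid)) (M : matroid) : matroid :=
  foldl (fun N g => g N) M gs.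

Definition class_N0 (N : matroid) : Prop := mdim N = 1%N.

Definition class_M0 (N : matroid) : Prop :=
  exists (gs : seq (matroid -> matroid)) (N0 : matroid),
    [/\ List.Forall (fun g => [\/ g = alpha0, g = alpha1 | g = beta1]) gs,
        class_N0 N0 & N = apply_ops gs N0].

Definition class_M1 (N : matroid) : Prop :=
  exists (gs : seq (matroid -> matroid)) (M : matroid),
    [/\ List.Forall (fun g => g = alpha0 \/ g = alpha1) gs,
        class_M0 M & N = apply_ops gs (beta0 M)].

(* Main.v *)
Require Import Defs.
From mathcomp Require Import all_boot all_order all_algebra.

(** Both classes together consist of the restrictions to nonzero vectors of
    the "decision lists" on F_2^n: colourings that are constant on some affine
    hyperplane and, recursively, decision lists on the complementary one.  So
    the point is that an AI_4-free colouring is constant on some affine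
    hyperplane, up to the point 0.  By induction (restricting to an affine
    hyperplane missing 0) it is constant, say one, on a coset B of codimension
    2.  In each of the three other cosets of the direction D of B consider the
    set S_i of zeros and its stabiliser K_i.  AI_4-freeness applied to two
    zeros of one coset and one of each of the others gives
    S_i + S_i <= K_j U K_k.  Since a group is not the union of two proper
    subgroups, all S_i + S_i lie in a common group K that stabilises two of the
    S_i.  If K = D, two cosets consist of zeros; otherwise a hyperplane
    of D containing K yields an affine hyperplane of ones. *)

Set Implicit Arguments.
Unset Strict Implicit.
Unset Printing Implicit Defensive.

Import GRing.Theory.
Local Open Scope ring_scope.

(** * Vectors over F_2, their pairing with columns, and the triple-sum condition *)

Local Notation vec n := 'rV['F_2]_n.

Lemma F2P (a : 'F_2) : a = 0 \/ a = 1.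
Proof. by case: a => [[|[|//]] i]; [left | right]; apply/val_inj. Qed.

Lemma rV2_addxx n (x : vec n) : x + x = 0.
Proof.
apply/rowP => i; rewrite !mxE.
by case: (F2P (x 0 i)) => ->; apply/val_inj.
Qed.

Lemma rV2_addxK n (x y : vec n) : x + y + y = x.
Proof. by rewrite -addrA rV2_addxx addr0. Qed.

Lemma rV2_addKx n (x y : vec n) : x + (x + y) = y.
Proof. by rewrite addrA rV2_addxx add0r. Qed.

Lemma rV2_add_eq0 n (x y : vec n) : (x + y == 0) = (x == y).
Proof. by rewrite -(inj_eq (addIr y)) rV2_addxK add0r. Qed.

Ltac vec_ring := apply/rowP => ?; rewrite !mxE;
  repeat match goal with |- context [fun_of_matrix ?x ?i ?j] =>
    let H := fresh in case: (F2P (x i j)) => H; rewrite !H {H} end;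
  by apply/val_inj.

Definition dot n (x : vec n) (u : 'cV['F_2]_n) : 'F_2 := (x *m u) 0 0.

Lemma dotDl n (x y : vec n) u : dot (x + y) u = dot x u + dot y u.
Proof. by rewrite /dot mulmxDl mxE. Qed.

Lemma dotDr n (x : vec n) u v : dot x (u + v) = dot x u + dot x v.
Proof. by rewrite /dot mulmxDr mxE. Qed.

Lemma dotZr n (x : vec n) a u : dot x (a *: u) = a * dot x u.
Proof. by rewrite /dot -scalemxAr mxE. Qed.

Lemma dot0l n (u : 'cV['F_2]_n) : dot 0 u = 0.
Proof. by rewrite /dot mul0mx mxE. Qed.

Lemma dot0r n (x : vec n) : dot x 0 = 0.
Proof. by rewrite /dot mulmx0 mxE. Qed.

(* The points of [Q] outside [P] (only 0, later on) count as members among the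
   triple sums but not among the summands.  No independence is required: for
   dependent [x, y, z, t] some triple sum is 0 or one of the four points. *)
Definition AI n (P Q : pred (vec n)) := forall x y z t : vec n,
  P x -> P y -> P z -> P t ->
  [|| Q (x + y + z), Q (x + y + t), Q (x + z + t) | Q (y + z + t)].

(** Forming triple sums is an involution on quadruples: the triple sums of the four triple sums are
    the original points. So if all triple sums of four points outside [Q] were in [P], one of these
    points would be in [Q]. This makes zeros and ones interchangeable. *)
Lemma AI_compl n (P Q : pred (vec n)) : AI P Q -> AI (predC Q) (predC P).
Proof.
move=> PQ x y z t /= Qx Qy Qz Qt; apply: contraT.
rewrite !negb_or !negbK => /and4P[Px Py Pz Pt].
have := PQ _ _ _ _ Px Py Pz Pt.
have -> : x + y + z + (x + y + t) + (x + z + t) = x by vec_ring.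
have -> : x + y + z + (x + y + t) + (y + z + t) = y by vec_ring.
have -> : x + y + z + (x + z + t) + (y + z + t) = z by vec_ring.
have -> : x + y + t + (x + z + t) + (y + z + t) = t by vec_ring.
by rewrite (negPf Qx) (negPf Qy) (negPf Qz) (negPf Qt).
Qed.

(** * Subgroups of F_2^n and stabilisers of sets *)

(** Fix [a] in [A] outside [B], hence in [C]. For [b] in [A], if [a + b] is in [B] then [b] is not,
    so [b] is in [C]; if [a + b] is in [C], so is [b]. *)
Lemma subgroup_cover n (A B C : pred (vec n)) :
  (forall x y, A x -> A y -> A (x + y)) ->
  (forall x y, B x -> B y -> B (x + y)) ->
  (forall x y, C x -> C y -> C (x + y)) ->
  (forall x, A x -> B x \/ C x) ->
  (forall x, A x -> B x) \/ (forall x, A x -> C x).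
Proof.
move=> AD BD CD ABC.
have [/forallP AB|/forallPn[a]] := boolP [forall x, A x ==> B x].
  by left=> x; apply/implyP.
rewrite negb_imply => /andP[Aa Ba]; right=> b Ab.
have Ca : C a by case: (ABC a Aa) Ba => // ->.
have [Bab|Cab] := ABC _ (AD _ _ Aa Ab).
  have [Bb|//] := ABC _ Ab; move: (BD _ _ Bab Bb); rewrite rV2_addxK.
  by rewrite (negPf Ba).
by have := CD _ _ Ca Cab; rewrite rV2_addKx.
Qed.

Definition stab n (S T : pred (vec n)) : pred (vec n) :=
  [pred d | [forall x, S x ==> T (x + d)]].

Lemma stabP n (S T : pred (vec n)) d :
  reflect (forall x, S x -> T (x + d)) (stab S T d).
Proof.
by apply: (iffP forallP) => h x; [move=> Sx; apply: implyP (h x) Sx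
  | apply/implyP/h].
Qed.

(* [T] is [S], possibly with 0 added; such a [stab S T] is still a group. *)
Lemma stabD n (S T : pred (vec n)) :
  (forall x, S x -> T x) -> (forall x, T x -> x != 0 -> S x) ->
  forall d e, stab S T d -> stab S T e -> stab S T (d + e).
Proof.
move=> ST TS d e /stabP Kd /stabP Ke; apply/stabP => x Sx.
have [x_d|x_d] := eqVneq (x + d) 0; last first.
  by rewrite addrA; apply/Ke/TS => //; apply: Kd.
have [x_e|x_e] := eqVneq (x + e) 0; last first.
  by rewrite (addrC d) addrA; apply/Kd/TS => //; apply: Ke.
have -> : d + e = 0.
  by rewrite -[RHS](addr0 0) -{1}x_d -x_e; vec_ring.
by rewrite addr0; apply: ST.
Qed.

Section ThreeSets.
Variables (n : nat) (S1 T1 S2 S3 : pred (vec n)) (p q r : vec n).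
Hypotheses (S1p : S1 p) (S2q : S2 q) (S3r : S3 r).
Hypotheses (ST1 : forall x, S1 x -> T1 x)
  (TS1 : forall x, T1 x -> x != 0 -> S1 x).
Let K1 := stab S1 T1.
Let K2 := stab S2 S2.
Let K3 := stab S3 S3.
Hypothesis H1 : forall x y, S1 x -> S1 y -> K2 (x + y) \/ K3 (x + y).
Hypothesis H2 : forall x y, S2 x -> S2 y -> K1 (x + y) \/ K3 (x + y).
Hypothesis H3 : forall x y, S3 x -> S3 y -> K1 (x + y) \/ K2 (x + y).

(** An element [d] of [K2] is the difference of the points [q] and [q + d] of [S2], so [H2] puts it
    in [K1] or [K3]; similarly for [K3]. For [K1] this can fail, since [p + d] may be the added
    point 0. Hence the split on whether [K2] and [K3] cover [K1]. *)
Lemma common_stab : exists K : pred (vec n),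
  [/\ forall x y, K x -> K y -> K (x + y),
      (forall x y, S1 x -> S1 y -> K (x + y)) /\
      (forall x y, S2 x -> S2 y -> K (x + y)) /\
      (forall x y, S3 x -> S3 y -> K (x + y)) &
      [\/ (forall d, K d -> K1 d /\ K2 d),
          (forall d, K d -> K1 d /\ K3 d) |
          (forall d, K d -> K2 d /\ K3 d)]].
Proof.
have K1D := stabD ST1 TS1; rewrite -/K1 in K1D.
have K2D : forall d e, K2 d -> K2 e -> K2 (d + e) by apply: stabD.
have K3D : forall d e, K3 d -> K3 e -> K3 (d + e) by apply: stabD.
have K2_13 d : K2 d -> K1 d \/ K3 d.
  move=> /stabP/(_ q S2q) S2d.
  by have := H2 S2q S2d; rewrite rV2_addKx.
have K3_12 d : K3 d -> K1 d \/ K2 d.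
  move=> /stabP/(_ r S3r) S3d.
  by have := H3 S3r S3d; rewrite rV2_addKx.
have s2 := subgroup_cover K2D K1D K3D K2_13.
have s3 := subgroup_cover K3D K1D K2D K3_12.
have [/forallP K1_23|] := boolP [forall x, K1 x ==> K2 x || K3 x].
  have {}K1_23 x : K1 x -> K2 x \/ K3 x.
    by move=> K1x; apply/orP/(implyP (K1_23 x)).
  have s1 := subgroup_cover K1D K2D K3D K1_23.
  (* Each of the three groups lies in another one. Following these inclusions closes a cycle, so two
     groups coincide; the third then lies in them, and the common group serves as [K]. *)
  have [[s12 s21]|[[s13 s31]|[s23 s32]]] :
    ((forall x, K1 x -> K2 x) /\ (forall x, K2 x -> K1 x)) \/
    ((forall x, K1 x -> K3 x) /\ (forall x, K3 x -> K1 x)) \/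
    ((forall x, K2 x -> K3 x) /\ (forall x, K3 x -> K2 x)).
  - case: s1 s2 s3 => [a|a] [b|b] [c|c]; try by [left|right;left|right;right].
    + by left; split=> // x /b/c.
    + by right; left; split=> // x /c/b.
  - have s3' x : K3 x -> K1 x by case/K3_12 => // /s21.
    exists K1; split=> //; [do ![split] | by apply: Or31 => d K1d; split; auto].
    + by move=> x y Sx Sy; case: (H1 Sx Sy); auto.
    + by move=> x y Sx Sy; case: (H2 Sx Sy); auto.
    + by move=> x y Sx Sy; case: (H3 Sx Sy); auto.
  - have s2' x : K2 x -> K1 x by case/K2_13 => // /s31.
    exists K1; split=> //; [do ![split] | by apply: Or32 => d K1d; split; auto].
    + by move=> x y Sx Sy; case: (H1 Sx Sy); auto.
    + by move=> x y Sx Sy; case: (H2 Sx Sy); auto.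
    + by move=> x y Sx Sy; case: (H3 Sx Sy); auto.
  - have s1' x : K1 x -> K2 x by case/K1_23 => // /s32.
    exists K2; split=> //; [do ![split] | by apply: Or33 => d K2d; split; auto].
    + by move=> x y Sx Sy; case: (H1 Sx Sy); auto.
    + by move=> x y Sx Sy; case: (H2 Sx Sy); auto.
    + by move=> x y Sx Sy; case: (H3 Sx Sy); auto.
move=> /forallPn[k]; rewrite negb_imply negb_or => /and3P[K1k K2k K3k].
(* Here [S1 = {k}] and [K1 = {0, k}]. *)
have S1k x : S1 x -> x = k.
  move=> S1x; apply/eqP; rewrite -rV2_add_eq0; apply: contraT => xk0.
  have S1xk : S1 (x + k) by apply: TS1 => //; move/stabP: K1k; apply.
  by have := H1 S1x S1xk; rewrite rV2_addKx (negPf K2k) (negPf K3k) => -[].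
have K1E d : K1 d -> d = 0 \/ d = k.
  move=> /stabP/(_ p S1p) T1d; rewrite (S1k p) // in T1d.
  have [kd|kd] := eqVneq (k + d) 0.
    by right; apply/eqP; rewrite -rV2_add_eq0 addrC kd.
  by left; rewrite -(rV2_addKx k d) (S1k _ (TS1 T1d kd)) rV2_addxx.
have K20 : K2 0 by apply/stabP => x; rewrite addr0.
have K30 : K3 0 by apply/stabP => x; rewrite addr0.
have s23 d : K2 d -> K3 d.
  move=> K2d; have [/K1E[->//|dk]|//] := K2_13 _ K2d.
  by rewrite dk (negPf K2k) in K2d.
have s32 d : K3 d -> K2 d.
  move=> K3d; have [/K1E[->//|dk]|//] := K3_12 _ K3d.
  by rewrite dk (negPf K3k) in K3d.
exists K2; split=> //; [do ![split] | by apply: Or33 => d K2d; split; auto].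
- by move=> x y /S1k-> /S1k->; rewrite rV2_addxx.
- move=> x y Sx Sy; have [/K1E[->//|xyk]|/s32//] := H2 Sx Sy.
  (* If [x + y = k], then [k] would stabilise [S2]: any [z] in [S2] is [x], or [x + k], or differs
     from [x] by an element of [K2], and [z + k] is then [y], [x], or a translate of [y] by that
     element. *)
  case/negP: K2k; apply/stabP => z Sz.
  have [/K1E[xz|xz]|/s32/stabP xz] := H2 Sx Sz.
  + have -> : z + k = y by rewrite -xyk -{1}(rV2_addKx x z) xz; vec_ring.
    by [].
  + by have -> : z + k = x by rewrite -xz; vec_ring.
  + have -> : z + k = y + (x + z) by rewrite -xyk; vec_ring.
    exact: xz.
- move=> x y Sx Sy; have [/K1E[->//|xyk]|//] := H3 Sx Sy.
  case/negP: K3k; apply/stabP => z Sz.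
  have [/K1E[xz|xz]|/s23/stabP xz] := H3 Sx Sz.
  + have -> : z + k = y by rewrite -xyk -{1}(rV2_addKx x z) xz; vec_ring.
    by [].
  + by have -> : z + k = x by rewrite -xz; vec_ring.
  + have -> : z + k = y + (x + z) by rewrite -xyk; vec_ring.
    exact: xz.
Qed.
End ThreeSets.

(** * Linear functionals and monochromatic affine hyperplanes *)

Lemma dot_col n m (x : vec n) (A : 'M_(n, m)) j :
  dot x (col j A) = (x *m A) 0 j.
Proof. by rewrite /dot !mxE; apply: eq_bigr => i _; rewrite mxE. Qed.

(** Over F_2 a set containing 0 and closed under sums is a subspace, here the row space of the
    matrix [A] listing it. Since [d] is not in it, some column of the cokernel of [A] does not kill
    [d]. *)
Lemma separating_functional n (K : pred (vec n)) d :
  K 0 -> (forall x y, K x -> K y -> K (x + y)) -> ~~ K d ->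
  exists2 u, forall x, K x -> dot x u = 0 & dot d u = 1.
Proof.
move=> K0 KD Kd; pose A := \matrix_(i < #|K|) (enum_val i : vec n).
have KA x : K x -> (x <= A)%MS.
  move=> Kx; have xK : x \in K by [].
  by rewrite -[x](enum_rankK_in xK) // -(rowK (fun i => enum_val i)) row_sub.
have AK x : (x <= A)%MS -> K x.
  move=> /submxP[c ->]; rewrite mulmx_sum_row.
  apply: (big_ind (fun x => K x)) => // i _; rewrite rowK.
  case: (F2P (c 0 i)) => ->; rewrite ?scale0r ?scale1r //.
  exact: (enum_valP i).
have /rV0Pn[j] : d *m cokermx A != 0.
  by apply: contra Kd => dA; apply/AK; rewrite submxE.
move=> dj; exists (col j (cokermx A)) => [x /KA|].
  by rewrite submxE dot_col => /eqP ->; rewrite mxE.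
rewrite dot_col; case: (F2P ((d *m cokermx A) 0 j)) dj => // ->.
by rewrite eqxx.
Qed.

Definition mono_hyperplane n (P Q : pred (vec n)) := exists u c, u != 0 /\
  ((forall x, dot x u = c -> Q x) \/ (forall x, dot x u = c -> ~~ P x)).

Lemma mono_hyperplane_compl n (P Q : pred (vec n)) :
  mono_hyperplane (predC Q) (predC P) -> mono_hyperplane P Q.
Proof.
case=> u [c [u0 h]]; exists u, c; split=> //.
case: h => h; [right|left] => x /h //.
by rewrite /= negbK.
Qed.

Section Codim2.
Variables (n : nat) (P Q : pred (vec n)) (u v : 'cV['F_2]_n).
Hypotheses (PQ : forall x, P x -> Q x)
  (QP : forall x, Q x -> x != 0 -> P x) (PQ_AI : AI P Q).

(** [S] and [T] can differ only at 0, hence only in [coset 0 0], the common direction of the four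
    cosets. That coset supplies the pair [S1], [T1] of [common_stab]. *)
Let coset (a b : 'F_2) x := (dot x u == a) && (dot x v == b).
Let S (a b : 'F_2) x := ~~ Q x && coset a b x.
Let T (a b : 'F_2) x := ~~ P x && coset a b x.

Hypothesis B : forall x, coset 0 1 x -> Q x.

Lemma coset_sum3 a b a' b' a'' b'' x y z :
  coset a b x -> coset a' b' y -> coset a'' b'' z ->
  coset (a + a' + a'') (b + b' + b'') (x + y + z).
Proof.
by do 3![move=> /andP[/eqP <- /eqP <-]]; rewrite /coset !dotDl !eqxx.
Qed.

Lemma S_sub_T a b x : S a b x -> T a b x.
Proof. by case/andP=> Qx xc; rewrite /T xc andbT; apply: contra Qx => /PQ. Qed.

Lemma T_sub_S a b x : T a b x -> x != 0 -> S a b x.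
Proof.
case/andP=> Px xc x0; rewrite /S xc andbT.
by apply: contra Px => /QP; apply.
Qed.

Lemma T_sub_S1 a b x : T a b x -> (a != 0) || (b != 0) -> S a b x.
Proof.
move=> Tx ab; apply: T_sub_S => //; case/andP: Tx => _.
by apply: contraTneq => ->; rewrite /coset !dot0l negb_and ![0 == _]eq_sym.
Qed.

(* The four zeros [x], [y], [s], [t] have two triple sums in the coset [B]
   of ones, so one of the two others is a zero. *)
Lemma diff_stab (a b a' b' a'' b'' : 'F_2) x y :
  a + a' + a'' = 0 -> b + b' + b'' = 1 -> S a b x -> S a b y ->
  stab (S a' b') (T a' b') (x + y) \/ stab (S a'' b'') (T a'' b'') (x + y).
Proof.
move=> aE bE /andP[Qx xc] /andP[Qy yc]; apply/orP/contraT.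
rewrite negb_or => /andP[/forallPn[s]]; rewrite negb_imply.
move=> /andP[/andP[Qs sc] Ts] /forallPn[t]; rewrite negb_imply.
move=> /andP[/andP[Qt tc] Tt].
have PB z : coset 0 1 z -> P z.
  move=> zc; apply: QP; first exact: B.
  by apply: contraTneq zc => ->; rewrite /coset !dot0l.
have aad (c d : 'F_2) : c + c + d = d.
  by case: (F2P c) => ->; case: (F2P d) => ->; apply/val_inj.
have := AI_compl PQ_AI Qx Qy Qs Qt; rewrite /predC /=.
rewrite (PB (x + s + t)) -?aE -?bE; last exact: coset_sum3.
rewrite (PB (y + s + t)) -?aE -?bE; last exact: coset_sum3.
rewrite !orbF => /orP[] h; [case/negP: Ts|case/negP: Tt]; rewrite addrC /T h /=.
  by rewrite -[X in coset X](aad a) -[X in coset _ X](aad b); apply: coset_sum3.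
by rewrite -[X in coset X](aad a) -[X in coset _ X](aad b); apply: coset_sum3.
Qed.

(** If one of the three other cosets has no zeros, it forms with [coset 0 1] an affine hyperplane of
    ones: [u = 0], [u + v = 1] or [v = 1]. Otherwise [common_stab] applies. *)
Lemma mono_hyperplane_of_codim2 :
  u != 0 -> v != 0 -> u != v -> mono_hyperplane P Q.
Proof.
move=> u0 v0 uv.
have uv0 : u + v != 0.
  apply: contra uv => /eqP uv0; apply/eqP/trmx_inj/eqP.
  by rewrite -rV2_add_eq0 -linearD uv0 /= trmx0.
have QE x : [|| Q x, S 0 0 x, S 1 0 x | S 1 1 x].
  rewrite /S /coset.
  case: (boolP (Q x)) => //= Qx.
  case: (F2P (dot x u)) => xu; case: (F2P (dot x v)) => xv; rewrite xu xv //=.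
  by case/negP: Qx; apply: B; rewrite /coset xu xv.
have [/forallP S1_0|/forallPn[p]] := boolP [forall x, ~~ S 0 0 x].
  exists u, 0; split=> //; left=> x xu; have := QE x.
  by rewrite (negPf (S1_0 x)) /S /coset xu /= !andbF !orbF.
rewrite negbK => S1p.
have [/forallP S2_0|/forallPn[q]] := boolP [forall x, ~~ S 1 0 x].
  exists (u + v), 1; split=> //.
  left=> x; rewrite dotDr => xuv; have := QE x.
  rewrite (negPf (S2_0 x)) /S /coset.
  by move: xuv; case: (F2P (dot x u)) => ->; case: (F2P (dot x v)) => -> //=;
    rewrite ?andbF ?orbF.
rewrite negbK => S2q.
have [/forallP S3_0|/forallPn[r]] := boolP [forall x, ~~ S 1 1 x].
  exists v, 1; split=> //; left=> x xv; have := QE x.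
  by rewrite (negPf (S3_0 x)) /S /coset xv /= !andbF !orbF.
rewrite negbK => S3r.
have ST a b : ((a != 0) || (b != 0)) -> S a b =1 T a b.
  by move=> ab x; apply/idP/idP => [/S_sub_T//|/T_sub_S1->].
have stabST a b : ((a != 0) || (b != 0)) ->
    stab (S a b) (T a b) =1 stab (S a b) (S a b).
  move=> ab d; apply/stabP/stabP => h x /h; by rewrite ST.
have [| | | | |K [KD [KS1 [KS2 KS3]] K23]] :=
  @common_stab _ (S 0 0) (T 0 0) (S 1 0) (S 1 1) p q r S1p S2q S3r.
- exact: S_sub_T.
- exact: T_sub_S.
- move=> x y Sx Sy; rewrite -!stabST //.
  by apply: (diff_stab _ _ Sx Sy); apply/val_inj.
- move=> x y Sx Sy; rewrite -!stabST //.
  by apply: (diff_stab _ _ Sx Sy); apply/val_inj.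
- move=> x y Sx Sy; rewrite -!stabST //.
  by apply: (diff_stab _ _ Sx Sy); apply/val_inj.
(* If [K] contains the whole direction, a coset whose zeros are stabilised by [K] is filled with
   zeros as soon as it has one. Two such cosets make up an affine hyperplane. *)
have [/forallP DK|/forallPn[d]] := boolP [forall d, coset 0 0 d ==> K d].
  have fill a b (S' T' : pred (vec n)) x y : S a b x -> coset a b y ->
      (forall d, K d -> stab (S a b) (T a b) d) -> ~~ P y.
    move=> /[dup] Sx /andP[_ /andP[/eqP xu /eqP xv]] /andP[/eqP yu /eqP yv] Kst.
    have /Kst/stabP/(_ x Sx) : K (x + y).
      apply: implyP (DK _) _; rewrite /coset !dotDl xu xv yu yv.
      by case: (F2P a) => ->; case: (F2P b) => ->.
    by rewrite rV2_addKx => /andP[].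
  case: K23 => K23.
  - exists v, 0; split=> //; right=> x xv.
    case: (F2P (dot x u)) => xu.
      apply: (fill 0 0 _ _ p x) => //; first by rewrite /coset xu xv.
      by move=> e /K23[].
    apply: (fill 1 0 _ _ q x) => //; first by rewrite /coset xu xv.
    by move=> e /K23[_ ?]; rewrite stabST.
  - exists (u + v), 0; split=> //; right=> x; rewrite dotDr => xuv.
    case: (F2P (dot x u)) => xu.
      apply: (fill 0 0 _ _ p x) => //; last by move=> e /K23[].
      by move: xuv; rewrite /coset xu add0r => ->.
    apply: (fill 1 1 _ _ r x) => //; last by move=> e /K23[_ ?]; rewrite stabST.
    by move: xuv; rewrite /coset xu; case: (F2P (dot x v)) => ->.
  - exists u, 1; split=> //; right=> x xu.
    case: (F2P (dot x v)) => xv.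
      apply: (fill 1 0 _ _ q x) => //; first by rewrite /coset xu xv.
      by move=> e /K23[? _]; rewrite stabST.
    apply: (fill 1 1 _ _ r x) => //; first by rewrite /coset xu xv.
    by move=> e /K23[_ ?]; rewrite stabST.
rewrite negb_imply => /andP[/andP[/eqP du /eqP dv] Kd].
have K0 : K 0 by rewrite -(rV2_addxx p); apply: KS1.
have [w Kw dw] := separating_functional K0 KD Kd.
(* [h] takes the same value at [p], [q] and [r]. *)
pose h := w + (dot p w + dot q w) *: u + (dot q w + dot r w) *: v.
have hE x : dot x h =
    dot x w + (dot p w + dot q w) * dot x u + (dot q w + dot r w) * dot x v.
  by rewrite !dotDr !dotZr.
(* On the zeros of one coset [u] and [v] are constant, and so is [w], which vanishes on [K]. *)
have S_const a b s x : (forall x y, S a b x -> S a b y -> K (x + y)) ->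
    S a b s -> S a b x -> dot x h = dot s h.
  move=> KS Ss Sx; have := Kw _ (KS _ _ Ss Sx).
  case/andP: Ss => _ /andP[/eqP su /eqP sv].
  case/andP: Sx => _ /andP[/eqP xu /eqP xv].
  rewrite dotDl !hE su sv xu xv => sx; congr (_ + _ + _).
  by move: sx; case: (F2P (dot s w)) => ->; case: (F2P (dot x w)) => ->.
have hp : dot p h = dot p w.
  by case/andP: S1p => _ /andP[/eqP pu /eqP pv]; rewrite hE pu pv !mulr0 !addr0.
have hq : dot q h = dot p w.
  case/andP: S2q => _ /andP[/eqP pu /eqP pv]; rewrite hE pu pv mulr0 mulr1.
  by case: (F2P (dot p w)) => ->; case: (F2P (dot q w)) => ->; apply/val_inj.
have hr : dot r h = dot p w.
  case/andP: S3r => _ /andP[/eqP pu /eqP pv]; rewrite hE pu pv !mulr1.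
  by case: (F2P (dot p w)) => ->; case: (F2P (dot q w)) => ->;
    case: (F2P (dot r w)) => ->; apply/val_inj.
(* All zeros have the [h]-value [dot p w], so the other value gives only ones; [h] is nonzero
   because it is 1 at [d]. *)
exists h, (dot p w + 1); split.
  apply/eqP => h0; have := hE d.
  by rewrite h0 dot0r du dv dw !mulr0 !addr0.
left=> x xh; have pw : dot p w <> dot p w + 1.
  by case: (F2P (dot p w)) => ->.
have /or4P[//|Sx|Sx|Sx] := QE x; case: pw; rewrite -[RHS]xh.
- by rewrite -hp; apply/esym/(S_const 0 0).
- by rewrite -hq; apply/esym/(S_const 1 0).
- by rewrite -hr; apply/esym/(S_const 1 1).
Qed.
End Codim2.

(** Induction through [e], which identifies the smaller space with the affine hyperplane of first
    coordinate 1. Sums of three points stay in it and it misses 0, so [P] and [Q] agree there. An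
    affine hyperplane of it is a coset of codimension 2; if it consists of zeros, colours are
    swapped by [AI_compl]. *)
Lemma mono_hyperplane_exists n (P Q : pred (vec n.+1)) :
  (forall x, P x -> Q x) -> (forall x, Q x -> x != 0 -> P x) -> AI P Q ->
  mono_hyperplane P Q.
Proof.
elim: n P Q => [|n IHn] P Q PQ QP PQ_AI.
  exists (const_mx 1), 1; split.
    by apply/eqP => /matrixP/(_ 0 0); rewrite !mxE.
  have xE (x : vec 1) : dot x (const_mx 1) = 1 -> x = const_mx 1.
    rewrite /dot mxE big_ord1 mxE mulr1 => x1; apply/rowP => i.
    by rewrite ord1 x1 mxE.
  have [P1|P1] := boolP (P (const_mx 1)); [left | right] => x /xE -> //.
  exact: PQ.
pose e x : vec (1 + n.+1) := row_mx 1 x.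
have eD x y z : e x + e y + e z = e (x + y + z).
  rewrite /e !add_row_mx; congr row_mx.
  by rewrite -[RHS]addr0 -(rV2_addxx (1 : vec 1)) addrA.
have e0 x : e x != 0.
  apply/eqP; rewrite -(@row_mx0 _ 1 1 n.+1) => /eq_row_mx[/matrixP/(_ 0 0)].
  by rewrite !mxE.
have QPe x : Q (e x) -> P (e x) by move=> Qx; apply: QP.
have [] := IHn (P \o e) (P \o e) => //.
  move=> x y z t Px Py Pz Pt; have := PQ_AI _ _ _ _ Px Py Pz Pt.
  rewrite !eD /= => /or4P[] /QPe -> //; by rewrite !orbT.
move=> u [c [u0 mono]].
(* The entry [c] pairs with the leading 1 of [e x], so that [dot (e x) U = 0] exactly when
   [dot x u = c]. *)
pose U : 'cV['F_2]_(1 + n.+1) := col_mx c%:M u.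
pose W : 'cV['F_2]_(1 + n.+1) := col_mx 1 0.
have dotU a x : dot (row_mx a x : vec (1 + n.+1)) U = a 0 0 * c + dot x u.
  rewrite /dot mul_row_col mxE; congr (_ + _).
  by rewrite mul_mx_scalar mxE mulrC.
have dotW a x : dot (row_mx a x : vec (1 + n.+1)) W = a 0 0.
  by rewrite /dot mul_row_col mulmx1 mulmx0 addr0.
have U0 : U != 0.
  by rewrite -(@col_mx0 _ 1 n.+1 1); apply: contra u0 => /eqP/eq_col_mx[_ ->].
have W0 : W != 0.
  apply/eqP; rewrite -(@col_mx0 _ 1 n.+1 1) => /eq_col_mx[/matrixP/(_ 0 0)].
  by rewrite !mxE.
have UW : U != W by apply: contra u0 => /eqP/eq_col_mx[_ ->].
have BE (x : vec (1 + n.+1)) : (dot x U == 0) && (dot x W == 1) ->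
    exists2 y, x = e y & dot y u = c.
  rewrite -[x]hsubmxK dotU dotW => /andP[xU /eqP x1]; exists (rsubmx x).
    by congr row_mx; apply/rowP => i; rewrite ord1 x1 mxE.
  move: xU; rewrite x1 mul1r.
  by case: (F2P c) => ->; case: (F2P (dot (rsubmx x) u)) => ->.
case: mono => mono.
  apply: (@mono_hyperplane_of_codim2 _ P Q U W) => // x /BE[y -> /mono].
  exact: PQ.
apply/mono_hyperplane_compl/(@mono_hyperplane_of_codim2 _ _ _ U W) => //.
- by move=> x; apply/contra/PQ.
- by move=> x Px x0; apply: contra Px => /QP; apply.
- exact: AI_compl.
- by move=> x /BE[y -> /mono].
Qed.

(** * From independent quadruples to the triple-sum condition *)

Definition or0 n (E : {set vec n}) : pred (vec n) :=
  [pred x | (x == 0) || (x \in E)].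

Local Notation o0 := (@Ordinal 4 0 isT).
Local Notation o1 := (@Ordinal 4 1 isT).
Local Notation o2 := (@Ordinal 4 2 isT).
Local Notation o3 := (@Ordinal 4 3 isT).

Lemma ord4P (i : 'I_4) : [\/ i = o0, i = o1, i = o2 | i = o3].
Proof.
by case: i => [[|[|[|[|//]]]] i];
  [apply: Or41|apply: Or42|apply: Or43|apply: Or44]; apply: val_inj.
Qed.

Lemma sum_ord4 (V : nmodType) (F : 'I_4 -> V) :
  \sum_(i < 4) F i = F o0 + F o1 + F o2 + F o3.
Proof.
by rewrite !big_ord_recr big_ord0 /= add0r;
  do ![congr (_ + _)]; congr F; apply: val_inj.
Qed.

Lemma sum_but4 (V : nmodType) (F : 'I_4 -> V) :
  [/\ \sum_(j < 4 | j != o0) F j = F o1 + F o2 + F o3,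
      \sum_(j < 4 | j != o1) F j = F o0 + F o2 + F o3,
      \sum_(j < 4 | j != o2) F j = F o0 + F o1 + F o3 &
      \sum_(j < 4 | j != o3) F j = F o0 + F o1 + F o2].
Proof. by split; rewrite big_mkcond sum_ord4 /= ?add0r ?addr0. Qed.

Lemma zero_notin_elts (M : matroid) : 0 \notin elts M.
Proof. by apply/negP => /(subsetP (elts_sub M)); rewrite inE eqxx. Qed.

(** If no triple sum is 0 or an element, the quadruple is independent: two equal points would make a
    triple sum equal to a third point, and a vanishing total would make one equal to the fourth.
    Conversely, a triple sum of an independent quadruple is never 0. *)
Lemma AI4_freeE (M : matroid) :
  AI4_free M <-> AI [in elts M] (or0 (elts M)).
Proof.
have nz x : x \in elts M -> x != 0.
  by apply: contraTneq => ->; apply: zero_notin_elts.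
split=> [free_AI x y z t Ex Ey Ez Et | M_AI s free_s sE].
  apply: contraT; rewrite /or0 /= !negb_or.
  case/and4P=> /andP[xyz0 xyz] /andP[xyt0 xyt] /andP[xzt0 xzt] /andP[yzt0 yzt].
  pose s := [tuple x; y; z; t].
  have neq a b c : a + b + c \notin elts M -> c \in elts M -> a + b != 0.
    by move=> abc Ec; apply: contra abc => /eqP->; rewrite add0r.
  have free_s : free s.
    apply/freeP => k; rewrite sum_ord4 /= => /eqP.
    have xyzt0 : x + y + z + t != 0.
      by apply: contra xyz; rewrite rV2_add_eq0 => /eqP->.
    have xy0 := neq _ _ _ xyz Ez.
    have xz0 : x + z != 0 by apply: (neq _ _ y) => //; rewrite addrAC.
    have xt0 : x + t != 0 by apply: (neq _ _ y) => //; rewrite addrAC.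
    have yz0 : y + z != 0 by apply: (neq _ _ x) => //; rewrite addrC addrA.
    have yt0 : y + t != 0 by apply: (neq _ _ x) => //; rewrite addrC addrA.
    have zt0 : z + t != 0 by apply: (neq _ _ x) => //; rewrite addrC addrA.
    (* This disposes of the fifteen nonzero coefficient vectors; only the zero vector is left
       afterwards. *)
    have zcase (a : vec (mdim M)) : a != 0 -> a == 0 -> forall i, k i = 0.
      by move=> /negPf->.
    case: (F2P (k o0)) (F2P (k o1)) (F2P (k o2)) (F2P (k o3)) =>
      [k0|k0] [k1|k1] [k2|k2] [k3|k3];
      rewrite k0 k1 k2 k3 ?scale0r ?scale1r ?add0r ?addr0;
      try by apply: zcase => //; apply: nz.
    by move=> _ i; case: (ord4P i) => ->.
  have [|i] := free_AI s free_s.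
    by move=> a; rewrite !inE => /or4P[] /eqP->.
  have [s0 s1 s2 s3] := sum_but4 (tnth s).
  by case: (ord4P i) => ->; rewrite ?s0 ?s1 ?s2 ?s3 => sE;
    rewrite sE in xyz xyt xzt yzt.
pose F := tnth s.
have FE i : F i \in elts M by apply/sE/mem_tnth.
suff [i] : exists i, or0 (elts M) (\sum_(j < 4 | j != i) tnth s j).
  case/orP=> [/eqP si0|]; last by exists i.
  have [j ji] : exists j : 'I_4, j != i.
    by case: (ord4P i) => ->; [exists o1|exists o0|exists o0|exists o0].
  have/freeP free0 := free_s.
  have : (j != i)%:R = 0 :> 'F_2.
    apply: (free0 (fun j => (j != i)%:R)).
    rewrite -[RHS]si0 [RHS]big_mkcond; apply: eq_bigr => l _.
    by case: (l != i); rewrite ?scale1r ?scale0r // (tnth_nth 0).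
  by rewrite ji => /eqP; rewrite oner_eq0.
have [s0 s1 s2 s3] := sum_but4 (tnth s).
have := M_AI _ _ _ _ (FE o0) (FE o1)
  (FE o2) (FE o3).
case/or4P => sQ.
- by exists o3; rewrite s3.
- by exists o2; rewrite s2.
- by exists o1; rewrite s1.
- by exists o0; rewrite s0.
Qed.

(** * Coordinates adapted to a hyperplane, and membership in the four extensions *)

(** The rows of [G] are a basis of the kernel of [u] followed by [w], which lies outside that
    kernel. This moves an arbitrary hyperplane and point off it to the standard position used by the
    operations. *)
Lemma hyperplane_basis m n (u : 'cV['F_2]_n) (w : vec n) :
  n = (m + 1)%N -> dot w u = 1 ->
  exists G : 'M_(m + 1, n), exists G' : 'M_(n, m + 1),
    [/\ G *m G' = 1%:M, G' *m G = 1%:M,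
        forall x : vec m, dot (emb x *m G) u = 0 & apex m *m G = w].
Proof.
move=> en; subst n => wu.
have [K [Kfree Ku]] : exists K : 'M['F_2]_(m, m + 1), row_free K /\ K *m u = 0.
  have rk : \rank (kermx u) = m.
    rewrite mxrank_ker; suff -> : \rank u = 1%N by rewrite addn1 subn1.
    apply/eqP; rewrite eqn_leq rank_leq_col lt0n mxrank_eq0.
    by apply: contra_eq_neq wu => ->; rewrite dot0r eq_sym oner_neq0.
  have : row_base (kermx u) *m u = 0.
    by apply/sub_kermxP; rewrite eq_row_base.
  have := row_base_free (kermx u).
  move: (row_base (kermx u)); rewrite rk => K Kfree Ku; by exists K.
have wu' : w *m u = 1%:M by apply/rowP => i; rewrite ord1 [LHS]wu mxE.
pose G := col_mx K w.
have : G \in unitmx.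
  rewrite -row_free_unit; apply: inj_row_free => v.
  rewrite -[v]hsubmxK mul_row_col => vG.
  have v2 : rsubmx v = 0.
    move: (congr1 (mulmx^~ u) vG).
    by rewrite mulmxDl -!mulmxA Ku wu' mulmx0 mulmx1 mul0mx add0r.
  move: vG; rewrite v2 mul0mx addr0 => v1.
  suff -> : lsubmx v = 0 by rewrite row_mx0.
  by apply: (row_free_inj Kfree); rewrite v1 mul0mx.
move=> Gunit; exists G, (invmx G); split; rewrite ?mulmxV ?mulVmx //.
  by move=> x; rewrite /dot /emb mul_row_col mul0mx addr0 -mulmxA Ku mulmx0 mxE.
by rewrite /apex mul_row_col mul0mx mul1mx add0r.
Qed.

Lemma emb0 n : emb (0 : vec n) = 0.
Proof. exact: row_mx0. Qed.

Lemma embD n (x y : vec n) : emb (x + y) = emb x + emb y.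
Proof. by rewrite /emb add_row_mx addr0. Qed.

Lemma emb_inj n : injective (@emb n).
Proof. by move=> x y /eq_row_mx[]. Qed.

Lemma emb_neq_apex_emb n (x y : vec n) : emb x != apex n + emb y.
Proof.
apply/eqP; rewrite /emb /apex add_row_mx => /eq_row_mx[_ /matrixP/(_ 0 0)].
by rewrite !mxE.
Qed.

Lemma row_cases n (x : vec (n + 1)) :
  (exists y, x = emb y) \/ (exists y, x = apex n + emb y).
Proof.
rewrite -[x]hsubmxK; case: (F2P (rsubmx x 0 0)) => x0; [left|right];
  exists (lsubmx x); rewrite /emb /apex ?add_row_mx ?add0r ?addr0;
  by congr row_mx; apply/rowP => i; rewrite ord1 x0 mxE.
Qed.

Section ImageMembership.
Variables (n : nat) (E : {set vec n}) (y : vec n).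

Lemma mem_emb : (emb y \in @emb n @: E) = (y \in E).
Proof. by rewrite mem_imset //; apply: emb_inj. Qed.

Lemma mem_apex_emb : (apex n + emb y \in @emb n @: E) = false.
Proof.
apply/imsetP => -[x _] /eqP; rewrite eq_sym.
by rewrite (negPf (emb_neq_apex_emb _ _)).
Qed.

Lemma mem_apex_image :
  (apex n + emb y \in [set apex n + emb x | x in E]) = (y \in E).
Proof.
have inj : injective (fun x => apex n + emb x) by move=> a b /addrI/emb_inj.
exact: (mem_imset E y inj).
Qed.

Lemma mem_emb_apex_image : (emb y \in [set apex n + emb x | x in E]) = false.
Proof.
by apply/imsetP => -[x _] /eqP; rewrite (negPf (emb_neq_apex_emb _ _)).
Qed.

Lemma emb_eq_apex : (emb y == apex n) = false.
Proof.
by have := emb_neq_apex_emb y 0; rewrite emb0 addr0 => /negPf.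
Qed.

Lemma apex_emb_eq_apex : (apex n + emb y == apex n) = (y == 0).
Proof.
by rewrite -{2}[apex n]addr0 -emb0 (inj_eq (addrI _)) (inj_eq (@emb_inj n)).
Qed.

End ImageMembership.

Section OperationMembership.
Variables (n : nat) (E : {set vec n}) (y : vec n).

Lemma alpha0_emb : (emb y \in alpha0_set E) = (y \in E).
Proof. exact: mem_emb. Qed.

Lemma alpha0_apex : (apex n + emb y \in alpha0_set E) = false.
Proof. exact: mem_apex_emb. Qed.
Lemma alpha1_emb : y != 0 -> (emb y \in alpha1_set E) = (y \in E).
Proof.
move=> y0; rewrite /alpha1_set inE mem_emb inE mem_emb !inE emb_neq0 // y0.
by rewrite andbT orbF.
Qed.

Lemma alpha1_apex : apex n + emb y \in alpha1_set E.
Proof. by rewrite !inE !mem_apex_emb apex_emb_neq0. Qed.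

Lemma beta0_emb : (emb y \in beta0_set E) = false.
Proof. by rewrite !inE mem_emb_apex_image emb_eq_apex. Qed.

Lemma beta0_apex : (apex n + emb y \in beta0_set E) = or0 E y.
Proof. by rewrite !inE mem_apex_image apex_emb_eq_apex orbC. Qed.

Lemma beta1_emb : (emb y \in beta1_set E) = (y != 0).
Proof. by rewrite !inE mem_emb mem_emb_apex_image emb_eq_apex !inE !orbF. Qed.

Lemma beta1_apex : (apex n + emb y \in beta1_set E) = or0 E y.
Proof. by rewrite !inE mem_apex_image mem_apex_emb apex_emb_eq_apex orbC. Qed.
End OperationMembership.

(** * Closure and induction principles for the two classes *)

Lemma class_M0_ops N : class_M0 N ->
  [/\ class_M0 (alpha0 N), class_M0 (alpha1 N) & class_M0 (beta1 N)].
Proof.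
case=> gs [N0 [gsP N0P ->]]; split;
  [exists (rcons gs alpha0)|exists (rcons gs alpha1)|exists (rcons gs beta1)];
  exists N0; split=> //; rewrite ?/apply_ops ?foldl_rcons //;
  rewrite -cats1; apply/List.Forall_app; split=> //; constructor=> //;
  by [apply: Or31|apply: Or32|apply: Or33].
Qed.

Lemma class_M1_ops N : class_M1 N -> class_M1 (alpha0 N) /\ class_M1 (alpha1 N).
Proof.
case=> gs [N0 [gsP N0P ->]]; split;
  [exists (rcons gs alpha0)|exists (rcons gs alpha1)];
  exists N0; split=> //; rewrite ?/apply_ops ?foldl_rcons //;
  rewrite -cats1; apply/List.Forall_app; split=> //; constructor=> //;
  by [left|right].
Qed.

Lemma class_M0_ind (C : matroid -> Prop) :
  (forall N, mdim N = 1%N -> C N) ->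
  (forall N, C N -> [/\ C (alpha0 N), C (alpha1 N) & C (beta1 N)]) ->
  forall N, class_M0 N -> C N.
Proof.
move=> C1 Cop _ [gs [N0 [gsP /C1 CN0 ->]]].
elim: gs N0 CN0 gsP => //= g gs IHgs N0 /Cop[C0 C1' Cb] gsP.
have [gP gsP'] := proj1 (List.Forall_cons_iff _ _ _) gsP.
by apply: IHgs gsP'; case: gP => ->.
Qed.

Lemma class_M1_ind (C : matroid -> Prop) :
  (forall N, class_M0 N -> C (beta0 N)) ->
  (forall N, C N -> C (alpha0 N) /\ C (alpha1 N)) ->
  forall N, class_M1 N -> C N.
Proof.
move=> C1 Cop _ [gs [N0 [gsP /C1 + ->]]].
elim: gs (beta0 N0) gsP => //= g gs IHgs N gsP /Cop[CN0 CN1].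
have [gP gsP'] := proj1 (List.Forall_cons_iff _ _ _) gsP.
by apply: (IHgs _ gsP'); case: gP => ->.
Qed.

(** * From the triple-sum condition to membership in the classes *)

(** A linear isomorphism in matrix form, so that [n] and [k] need not be the same expression. The
    point 0 is exempt because [P] may hold there, whereas the elements of a matroid are nonzero. *)
Definition represents n (P : pred (vec n)) k (E : {set vec k}) :=
  exists A : 'M['F_2]_(n, k), exists B : 'M['F_2]_(k, n),
    [/\ A *m B = 1%:M, B *m A = 1%:M &
        forall x, x != 0 -> (x *m A \in E) = P x].

(** After the change of coordinates [G'], the isomorphism [A] of the hyperplanes is extended by
    sending apex to apex. *)
Lemma represents_ext n m k (G : 'M_(m + 1, n)) (G' : 'M_(n, m + 1))
    (A : 'M_(m, k)) (B : 'M_(k, m)) (P : pred (vec n)) (E : {set vec (k + 1)}) :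
  G *m G' = 1%:M -> G' *m G = 1%:M -> A *m B = 1%:M -> B *m A = 1%:M ->
  (forall x : vec m, x != 0 -> (emb (x *m A) \in E) = P (emb x *m G)) ->
  (forall x : vec m,
    (apex k + emb (x *m A) \in E) = P ((apex m + emb x) *m G)) ->
  represents P E.
Proof.
move=> GG' G'G AB BA E0 E1.
exists (G' *m block_mx A 0 0 1%:M), (block_mx B 0 0 1%:M *m G); split.
- rewrite mulmxA -[in X in X *m _]mulmxA mulmx_block AB !mulmx0 !mul0mx.
  rewrite !addr0 !add0r.
  by rewrite mulmx1 -scalar_mx_block mulmx1.
- rewrite mulmxA -[in X in X *m _]mulmxA GG' mulmx1 mulmx_block BA.
  by rewrite !mulmx0 !mul0mx !addr0 !add0r mulmx1 -scalar_mx_block.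
move=> x x0; rewrite -[in RHS](mulmx1 x) -G'G !mulmxA.
have : x *m G' != 0.
  apply: contra x0 => /eqP xG'.
  by rewrite -[x]mulmx1 -G'G mulmxA xG' mul0mx.
case: (row_cases (x *m G')) => -[y ->] y0.
  rewrite -E0; last by apply: contra y0 => /eqP->; rewrite emb0.
  by rewrite {1}/emb mul_row_block !mulmx0 !mul0mx !addr0.
rewrite -E1 /apex /emb !add_row_mx mul_row_block !addr0 !add0r.
by rewrite !mulmx0 !mulmx1 !addr0 !add0r.
Qed.

Lemma exists_dot1 n (u : 'cV['F_2]_n) : u != 0 -> exists w : vec n, dot w u = 1.
Proof.
case/matrix0Pn => i [j]; rewrite ord1 => ui; exists (delta_mx 0 i).
by rewrite /dot -rowE mxE; case: (F2P (u i 0)) ui => ->; rewrite ?eqxx.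
Qed.

Lemma represents_alpha n m (P : pred (vec n)) (u : 'cV['F_2]_n) (v : bool) :
  n = (m + 1)%N -> u != 0 -> (forall x, dot x u = 1 -> P x = v) ->
  exists g : vec m -> vec n,
    [/\ forall x y, g (x + y) = g x + g y, injective g &
    forall N, represents (P \o g) (elts N) ->
      represents P (elts ((if v then alpha1 else alpha0) N))].
Proof.
move=> en /exists_dot1[w wu] Pu.
have [G [G' [GG' G'G Gu Gw]]] := hyperplane_basis en wu.
exists (fun x => emb x *m G); split.
- by move=> x y; rewrite embD mulmxDl.
- move=> x y /(congr1 (mulmx^~ G')); rewrite -!mulmxA GG' !mulmx1.
  by move/emb_inj.
move=> N [A [B [AB BA NP]]].
have A0 x : x != 0 -> x *m A != 0.
  by apply: contra => /eqP xA; rewrite -[x]mulmx1 -AB mulmxA xA mul0mx.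
case: v Pu => Pu; apply: (represents_ext GG' G'G AB BA) => x.
- by move=> x0; rewrite alpha1_emb ?NP ?A0.
- by rewrite alpha1_apex Pu // mulmxDl dotDl Gu Gw wu addr0.
- by move=> x0; rewrite alpha0_emb ?NP ?A0.
- by rewrite alpha0_apex Pu // mulmxDl dotDl Gu Gw wu addr0.
Qed.

(** The remaining colouring lives on an affine hyperplane, read with [w] as origin. A representing
    matroid says nothing about this origin; [P w] settles it, since both beta operations contain the
    apex. *)
Lemma represents_beta n m (P : pred (vec n)) (u : 'cV['F_2]_n) w (v : bool) :
  n = (m + 1)%N -> dot w u = 1 -> P w ->
  (forall x, x != 0 -> dot x u = 0 -> P x = v) ->
  exists g : vec m -> vec n,
    [/\ forall x y, g (x + y) = g x + g y, injective g,
        forall x, dot (g x) u = 0 &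
    forall N, represents (fun x => P (w + g x)) (elts N) ->
      represents P (elts ((if v then beta1 else beta0) N))].
Proof.
move=> en wu Pw Pu.
have [G [G' [GG' G'G Gu Gw]]] := hyperplane_basis en wu.
have g_inj : injective (fun x => emb x *m G).
  move=> x y /(congr1 (mulmx^~ G')); rewrite -!mulmxA GG' !mulmx1.
  by move/emb_inj.
exists (fun x => emb x *m G); split=> //.
  by move=> x y; rewrite embD mulmxDl.
move=> N [A [B [AB BA NP]]].
have A0 x : (x *m A == 0) = (x == 0).
  apply/eqP/eqP => [xA|->]; last exact: mul0mx.
  by rewrite -[x]mulmx1 -AB mulmxA xA mul0mx.
have NP' x : or0 (elts N) (x *m A) = P ((apex m + emb x) *m G).
  rewrite /or0 /= A0 mulmxDl Gw.
  by have [->|/NP->] := eqVneq x 0; rewrite ?emb0 ?mul0mx ?addr0.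
have G0 x : x != 0 -> emb x *m G != 0.
  by apply: contra => /eqP xG; apply/eqP/g_inj; rewrite xG emb0 mul0mx.
case: v Pu => Pu; apply: (represents_ext GG' G'G AB BA) => x.
- by move=> x0; rewrite beta1_emb A0 x0 Pu ?G0.
- by rewrite beta1_apex NP'.
- by move=> x0; rewrite beta0_emb Pu ?G0.
- by rewrite beta0_apex NP'.
Qed.

Lemma AI_comp n m (P Q : pred (vec n)) (g : vec m -> vec n) :
  (forall x y z, g (x + y + z) = g x + g y + g z) ->
  AI P Q -> AI (P \o g) (Q \o g).
Proof. by move=> gD PQ x y z t Px Py Pz Pt; rewrite /= !gD; apply: PQ. Qed.

Lemma represents_dim1 (P : pred (vec 1)) :
  exists N, class_M0 N /\ represents P (elts N).
Proof.
have sub : [set x | (x != 0) && P x] \subset PG 1.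
  by apply/subsetP => x; rewrite !inE => /andP[].
exists (@Matroid 1 _ isT sub); split.
  by exists [::], (@Matroid 1 _ isT sub); split=> //; constructor.
exists 1%:M, 1%:M; split; rewrite ?mulmx1 // => x x0.
by rewrite mulmx1 /= inE x0.
Qed.

Lemma mono_hyperplaneE n (P Q : pred (vec n)) :
  (forall x, P x -> Q x) -> (forall x, Q x -> x != 0 -> P x) ->
  mono_hyperplane P Q ->
  exists u c v, u != 0 /\ forall x, x != 0 -> dot x u = c -> P x = v.
Proof.
move=> PQ QP [u [c [u0 [h|h]]]]; exists u, c; [exists true|exists false];
  split=> // x x0 xu; first by apply: QP => //; apply: h.
by apply/negbTE/h.
Qed.

Lemma dot1_neq0 n (x : vec n) u : dot x u = 1 -> x != 0.
Proof. by apply: contra_eq_neq => ->; rewrite dot0l eq_sym oner_neq0. Qed.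

Lemma add3_translate n (w a b d : vec n) :
  w + a + (w + b) + (w + d) = w + (a + b + d).
Proof. by vec_ring. Qed.

Lemma morph0 n m (g : vec m -> vec n) :
  (forall x y, g (x + y) = g x + g y) -> g 0 = 0.
Proof. by move=> gD; apply: (addrI (g 0)); rewrite -gD !addr0. Qed.

(** The origin is an ordinary point of colour one here. So a monochromatic linear hyperplane
    consists of ones and calls for [beta1], unless the other side has no ones and [alpha0] applies.
    The new origin [w] is again a one. *)
Lemma affine_AI_class n (P : pred (vec n)) :
  (0 < n)%N -> P 0 -> AI P P -> exists N, class_M0 N /\ represents P (elts N).
Proof.
case: n P => // n P _; elim: n P => [|n IHn] P P0 P_AI.
  exact: represents_dim1.
have en : n.+2 = (n.+1 + 1)%N by rewrite addn1.
have [u [c [u0 mono]]] :=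
  mono_hyperplane_exists (fun x h => h) (fun x h _ => h) P_AI.
have [v Pu] : exists v, forall x, dot x u = c -> P x = v.
  by case: mono => mono; [exists true|exists false => x /mono/negbTE].
have alphaP b : (forall x, dot x u = 1 -> P x = b) ->
    exists N, class_M0 N /\ represents P (elts N).
  move=> /(represents_alpha en u0)[g [gD _ gP]].
  have [||N [NM0 NP]] := IHn (P \o g).
  - by rewrite /= morph0.
  - by apply: AI_comp => // x y z; rewrite !gD.
  exists ((if b then alpha1 else alpha0) N); split; last exact: gP.
  by case: (class_M0_ops NM0) (b) => ? ? ? [].
case: (F2P c) => cE; rewrite {}cE in Pu; last first.
  exact: (alphaP v).
have [/existsP[w /andP[/eqP wu Pw]]|/existsPn P1] :=
    boolP [exists w, (dot w u == 1) && P w]; last first.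
  apply: (alphaP false) => x xu; apply/negbTE.
  by have := P1 x; rewrite xu eqxx.
have vT : v = true by rewrite -(Pu 0) ?dot0l.
rewrite {}vT in Pu.
have [g [gD _ gu gP]] := represents_beta en wu Pw (fun x _ => Pu x).
have [||N [NM0 NP]] := IHn (fun x => P (w + g x)).
- by rewrite morph0 // addr0.
- apply: (AI_comp (g := fun x => w + g x)) => // x y z.
  by rewrite !gD add3_translate.
by exists (beta1 N); split; [case: (class_M0_ops NM0)|exact: gP].
Qed.

(** An alpha step keeps the exempt origin, so the induction continues. A beta step passes to an
    affine hyperplane missing 0, where nothing is exempt and [affine_AI_class] finishes within
    [class_M0]. This is why [beta0] is applied directly to a member of [class_M0]. *)
Lemma AI_or0_class n (P : pred (vec n)) :
  (0 < n)%N -> AI P [pred x | (x == 0) || P x] ->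
  exists N, (class_M0 N \/ class_M1 N) /\ represents P (elts N).
Proof.
case: n P => // n P _; elim: n P => [|n IHn] P P_AI.
  by have [N [NM0 NP]] := represents_dim1 P; exists N; split=> //; left.
have en : n.+2 = (n.+1 + 1)%N by rewrite addn1.
pose Q := [pred x | (x == 0) || P x].
have PQ x : P x -> Q x by rewrite /Q /= => ->; rewrite orbT.
have QP x : Q x -> x != 0 -> P x by case/orP=> [->|].
have [u [c [v [u0 Pu]]]] :=
  mono_hyperplaneE PQ QP (mono_hyperplane_exists PQ QP P_AI).
have alphaP b : (forall x, dot x u = 1 -> P x = b) ->
    exists N, (class_M0 N \/ class_M1 N) /\ represents P (elts N).
  move=> /(represents_alpha en u0)[g [gD g_inj gP]].
  have [|N [NM NP]] := IHn (P \o g).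
    move=> x y z t Px Py Pz Pt; have := P_AI _ _ _ _ Px Py Pz Pt.
    by rewrite /= -!gD -(morph0 gD) !(inj_eq g_inj).
  exists ((if b then alpha1 else alpha0) N); split; last exact: gP.
  case: NM => [/class_M0_ops[? ? _]|/class_M1_ops[? ?]]; [left|right];
    by case: (b).
case: (F2P c) => cE; rewrite {}cE in Pu; last first.
  by apply: (alphaP v) => x xu; apply: Pu => //; apply: dot1_neq0 xu.
have [/existsP[w /andP[/eqP wu Pw]]|/existsPn P1] :=
    boolP [exists w, (dot w u == 1) && P w]; last first.
  apply: (alphaP false) => x xu; apply/negbTE.
  by have := P1 x; rewrite xu eqxx.
have [g [gD _ gu gP]] := represents_beta en wu Pw Pu.
have [|||N [NM0 NP]] := @affine_AI_class n.+1 (fun x => P (w + g x)) => //.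
- by rewrite morph0 // addr0.
- have QPg x : Q (w + g x) -> P (w + g x).
    move=> Qx; apply: QP => //; apply: (@dot1_neq0 _ _ u).
    by rewrite dotDl wu gu addr0.
  move=> x y z t Px Py Pz Pt; have := P_AI _ _ _ _ Px Py Pz Pt.
  have wD a b d : w + g a + (w + g b) + (w + g d) = w + g (a + b + d).
    by rewrite !gD add3_translate.
  by rewrite !wD => /or4P[] /QPg ->; rewrite ?orbT.
exists ((if v then beta1 else beta0) N); split; last exact: gP.
case: (v); [left|right]; first by case: (class_M0_ops NM0).
by exists [::], N; split=> //; constructor.
Qed.

(** * From membership in the classes to the triple-sum condition *)

(** Suppose the hyperplane lies in [Q]. Every point is the sum of three of the triple sums, and
    three points off an affine hyperplane sum to a point off it. So if all triple sums avoid the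
    hyperplane, all four points do, and the assumption on the other side applies. *)
Lemma AI_of_mono n (P Q : pred (vec n)) (u : 'cV['F_2]_n) c :
  (forall x, dot x u = c -> Q x) \/ (forall x, dot x u = c -> ~~ P x) ->
  AI [pred x | (dot x u != c) && P x] [pred x | (dot x u != c) && Q x] ->
  AI P Q.
Proof.
move=> mono AI' x y z t Px Py Pz Pt.
have [xyzt|] :=
  boolP [&& dot x u != c, dot y u != c, dot z u != c & dot t u != c].
  have [xu yu zu tu] := and4P xyzt.
  have := AI' x y z t; rewrite /= xu yu zu tu => /(_ Px Py Pz Pt).
  by case/or4P => /andP[_ ->]; rewrite ?orbT.
case: mono => mono; last first.
  have Pc a : P a -> dot a u != c by move=> Pa; apply: contraL Pa => /eqP/mono.
  by rewrite !Pc.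
move=> h; apply: contraT; rewrite !negb_or => /and4P[].
have Qc a : ~~ Q a -> dot a u != c by apply: contra => /eqP/mono.
move=> /Qc + /Qc + /Qc + /Qc; move: h; rewrite !dotDl.
by case: (F2P c) => ->; case: (F2P (dot x u)) => ->;
  case: (F2P (dot y u)) => ->; case: (F2P (dot z u)) => ->;
  case: (F2P (dot t u)) => ->.
Qed.

Definition last_coord n : 'cV['F_2]_(n + 1) := col_mx 0 1%:M.

Lemma dot_emb n (x : vec n) : dot (emb x) (last_coord n) = 0.
Proof. by rewrite /dot mul_row_col mulmx0 mul0mx addr0 mxE. Qed.

Lemma dot_apex n (x : vec n) : dot (apex n + emb x) (last_coord n) = 1.
Proof.
by rewrite dotDl dot_emb addr0 /dot mul_row_col mulmx0 mulmx1 add0r mxE.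
Qed.

Lemma AI_alpha n (P Q : pred (vec (n + 1))) :
  (forall y, Q (apex n + emb y)) \/ (forall y, ~~ P (apex n + emb y)) ->
  AI (P \o @emb n) (Q \o @emb n) -> AI P Q.
Proof.
move=> mono PQ; apply: (@AI_of_mono _ P Q (last_coord n) 1).
  by case: mono => h; [left|right] => x; case: (row_cases x) => -[y ->];
    rewrite ?dot_emb.
have emb_of x : (dot x (last_coord n) != 1) && P x ->
    exists2 y, x = emb y & P (emb y).
  case: (row_cases x) => -[y ->]; rewrite ?dot_apex // => /andP[_ Py].
  by exists y.
move=> x y z t /emb_of[x' -> Px] /emb_of[y' -> Py].
move=> /emb_of[z' -> Pz] /emb_of[t' -> Pt].
by rewrite /= -!embD !dot_emb; apply: PQ.
Qed.

Lemma AI_beta n (P Q : pred (vec (n + 1))) (f := fun y => apex n + emb y) :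
  (forall y, Q (emb y)) \/ (forall y, ~~ P (emb y)) ->
  AI (P \o f) (Q \o f) -> AI P Q.
Proof.
move=> mono PQ; apply: (@AI_of_mono _ P Q (last_coord n) 0).
  by case: mono => h; [left|right] => x; case: (row_cases x) => -[y ->];
    rewrite ?dot_apex.
have fD a b d : f a + f b + f d = f (a + b + d).
  by rewrite /f !embD add3_translate.
have f_of a : (dot a (last_coord n) != 0) && P a ->
    exists2 y, a = f y & P (f y).
  case: (row_cases a) => -[y ->]; rewrite ?dot_emb // => /andP[_ Py].
  by exists y.
move=> x y z t /f_of[x' -> Px] /f_of[y' -> Py] /f_of[z' -> Pz] /f_of[t' -> Pt].
by rewrite /= !fD !dot_apex; apply: PQ.
Qed.

Lemma eq_AI n (P P' Q Q' : pred (vec n)) :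
  P =1 P' -> Q =1 Q' -> AI P Q -> AI P' Q'.
Proof.
by move=> eP eQ PQ x y z t; rewrite -!eP -!eQ; apply: PQ.
Qed.

Lemma emb_eq0 n (y : vec n) : (emb y == 0) = (y == 0).
Proof. by rewrite -emb0 (inj_eq (@emb_inj n)). Qed.

Lemma or0_alpha0 n (E : {set vec n}) : or0 E =1 or0 (alpha0_set E) \o @emb n.
Proof. by move=> y; rewrite /or0 /= emb_eq0 alpha0_emb. Qed.

Lemma or0_alpha1 n (E : {set vec n}) : or0 E =1 or0 (alpha1_set E) \o @emb n.
Proof.
by move=> y; rewrite /or0 /= emb_eq0; case: eqVneq => // y0; rewrite alpha1_emb.
Qed.

(** Here 0 also counts among the summands, because a beta operation turns it into the apex, a
    genuine element. In dimension 1 two of any three vectors agree, so their sum is the third. *)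
Lemma class_M0_AI N : class_M0 N -> AI (or0 (elts N)) (or0 (elts N)).
Proof.
elim/class_M0_ind => {}N => [|NAI].
  case: N => n E /= _ _ n1; subst n => x y z t Ex Ey Ez _.
  have vec1 (a b : vec 1) : a 0 0 = b 0 0 -> a = b.
    by move=> ab; apply/rowP => i; rewrite ord1.
  have : [\/ x = y, y = z | x = z].
    case: (F2P (x 0 0)) => x0; case: (F2P (y 0 0)) => y0;
    case: (F2P (z 0 0)) => z0;
    by [apply/Or31/vec1; rewrite x0 y0|apply/Or32/vec1; rewrite y0 z0
       |apply/Or33/vec1; rewrite x0 z0].
  move=> xyz; apply/orP; left; case: xyz => ->.
  - by rewrite rV2_addxx add0r.
  - by rewrite rV2_addxK.
  - by rewrite addrAC rV2_addxx add0r.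
split.
- apply: AI_alpha; last exact: (eq_AI (or0_alpha0 _) (or0_alpha0 _) NAI).
  by right=> y; rewrite /or0 /= alpha0_apex (negPf (apex_emb_neq0 _)).
- apply: AI_alpha; last exact: (eq_AI (or0_alpha1 _) (or0_alpha1 _) NAI).
  by left=> y; rewrite /or0 /= alpha1_apex orbT.
- have e : or0 (elts N) =1
      or0 (beta1_set (elts N)) \o (fun y => apex _ + emb y).
    by move=> y; rewrite /or0 /= beta1_apex (negPf (apex_emb_neq0 _)).
  apply: AI_beta; last exact: (eq_AI e e NAI).
  by left=> y; rewrite /or0 /= beta1_emb emb_eq0 orbN.
Qed.

(** [beta0] leaves its hyperplane without elements, and this is constant only if 0 is excluded from
    the summands; hence the weaker form than for [class_M0]. *)
Lemma class_M1_AI N : class_M1 N -> AI [in elts N] (or0 (elts N)).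
Proof.
elim/class_M1_ind => {}N => [/class_M0_AI NAI|NAI].
  have e : or0 (elts N) =1
      or0 (beta0_set (elts N)) \o (fun y => apex _ + emb y).
    by move=> y; rewrite /or0 /= beta0_apex (negPf (apex_emb_neq0 _)).
  apply: AI_beta; last apply: (eq_AI _ e NAI).
    by right=> y; rewrite /= beta0_emb.
  by move=> y; rewrite /= beta0_apex.
split.
- apply: AI_alpha; last apply: (eq_AI _ (or0_alpha0 _) NAI).
    by right=> y; rewrite /= alpha0_apex.
  by move=> y; rewrite /= alpha0_emb.
- apply: AI_alpha; last apply: (eq_AI _ (or0_alpha1 _) NAI).
    by left=> y; rewrite /or0 /= alpha1_apex orbT.
  move=> y; rewrite /=; have [->|/alpha1_emb->//] := eqVneq y 0.
  rewrite emb0 (negPf (zero_notin_elts (alpha1 N))).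
  by rewrite (negPf (zero_notin_elts N)).
Qed.

Theorem theorem4p6 :
  forall M : matroid,
    AI4_free M <->
    exists N : matroid, (class_M0 N \/ class_M1 N) /\ isomorphic M N.
Proof.
move=> M; rewrite AI4_freeE; split.
  case/(AI_or0_class (mdim_gt0 M)) => N [NM [A [B [AB BA NP]]]].
  exists N; split=> //; exists (mulmxr A).
  have bij : bijective (mulmxr A : vec (mdim M) -> vec (mdim N)).
    by exists (mulmxr B) => x /=; rewrite -mulmxA ?AB ?BA mulmx1.
  have A0 (x : vec (mdim M)) : (x *m A == 0) = (x == 0).
    by have := inj_eq (bij_inj bij) x 0; rewrite /= mul0mx.
  split=> //; apply/setP => y; have [f fK Kf] := bij.
    rewrite -(Kf y) mem_imset; last exact: bij_inj.
    by rewrite !inE /= A0.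
  rewrite -(Kf y) mem_imset; last exact: bij_inj.
  (* [NP] is silent at 0, which belongs to neither matroid. *)
  have [->|y0] := eqVneq (f y) 0; last by rewrite NP.
  by rewrite /= mul0mx (negPf (zero_notin_elts M)) (negPf (zero_notin_elts N)).
case=> N [NM [f [bij _ fE]]].
have f_inj := bij_inj bij.
have f0 a : (f a == 0) = (a == 0) by rewrite -(raddf0 f) (inj_eq f_inj).
have NAI : AI [in elts N] (or0 (elts N)).
  case: NM => [/class_M0_AI NAI x y z t Ex Ey Ez Et|/class_M1_AI//].
  by apply: NAI; apply/orP; right.
have fEx x : (f x \in elts N) = (x \in elts M) by rewrite -fE mem_imset.
move=> x y z t /=; rewrite -!fEx => Ex Ey Ez Et.
have := NAI _ _ _ _ Ex Ey Ez Et.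
by rewrite -!raddfD /or0 /= !fEx !f0.
Qed.
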